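(* Let $s\ge1$ and suppose $a_1a_2\cdots a_{2s+2}\neq 1$. Let $\{i_1,i_2,\ldots,i_{s-1}\}\subset\{1,2,\ldots,2s+2\}$ (with $i_1,\ldots,i_{s-1}$ distinct) and let $j\in\{1,\ldots,2s+2\}$ with $j\notin\{i_1,\ldots,i_{s-1}\}$. Define $$v_0=e_{i_1}e_{i_2}\cdots e_{i_{s-1}},\qquad v_k=e_{i_1}\cdots\widehat{e}_{i_k}\cdots e_{i_{s-1}}\quad(1\le k\le s-1).$$ Then the Jackson integrals of type $BC_1$ satisfy the first order vector-valued $q$-difference equation $$T_{a_j}\big(\langle v_0,\xi\rangle,\ldots,\langle v_{s-1},\xi\rangle\big)=\big(\langle v_0,\xi\rangle,\ldots,\langle v_{s-1},\xi\rangle\big)B,\qquad B=UL,$$ where $U$ and $L$ are the $s\times s$ matrices $$U=\begin{pmatrix}c_0&1&1&\cdots&1\\ &c_1&&&\\ &&c_2&&\\ &&&\ddots&\\ &&&&c_{s-1}\end{pmatrix},\qquad L=\begin{pmatrix}1&&&&\\ d_1&1&&&\\ d_2&&1&&\\ \vdots&&&\ddots&\\ d_{s-1}&&&&1\end{pmatrix}$$ (blank entries are zero), with $$c_0=\frac{\prod_{m=1}^{2s+2}(1-a_ja_m)}{(-a_j)^s(1-a_1a_2\cdots a_{2s+2})(1-a_j^2)\prod_{\ell=1}^{s-1}e(a_{i_\ell};a_j)}$$ and, for $k=1,2,\ldots,s-1$, $$c_k=e(a_{i_k};a_j),\qquad d_k=\frac{\prod_{m=1}^{2s+2}(1-a_{i_k}a_m)}{(-a_{i_k})^s(1-a_1a_2\cdots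 a_{2s+2})(1-a_{i_k}^2)\,e(a_j;a_{i_k})\prod_{1\le\ell\le s-1,\ \ell\neq k}e(a_{i_\ell};a_{i_k})}.$$ Moreover, $$\det B=\frac{\prod_{m=1}^{2s+2}(1-a_ja_m)}{(-a_j)^s(1-a_1a_2\cdots a_{2s+2})(1-a_j^2)}.$$
   Context: Fix $0<q<1$, a positive integer $s$ and $\alpha_1,\ldots,\alpha_{2s+2}\in\mathbb{C}$, with $a_m=q^{\alpha_m}$. Write $(x)_\infty=\prod_{i=0}^\infty(1-q^ix)$. On $\mathbb{C}^*$ define $$\Phi(z)=\prod_{m=1}^{2s+2}z^{\frac12-\alpha_m}\frac{(qz/a_m)_\infty}{(a_mz)_\infty},\qquad \Delta(z)=z^{-1}-z.$$ Powers of $z$ are taken consistently along the lattice $\{q^\nu\xi\}_{\nu\in\mathbb{Z}}$: a branch of $\log\xi$ is fixed and $(q^\nu\xi)^c=q^{c\nu}\xi^c$. For a symmetric function $\varphi$ on $\mathbb{C}^*$ (i.e. $\varphi(z)=\varphi(z^{-1})$) and $\xi\in\mathbb{C}^*$, the Jackson integral of type $BC_1$ is $$\langle\varphi,\xi\rangle:=(1-q)\sum_{\nu=-\infty}^{\infty}\varphi(q^\nu\xi)\Phi(q^\nu\xi)\Delta(q^\nu\xi).$$ Set $e(x;y)=x+x^{-1}-(y+y^{-1})$, $e_i(z)=e(z;a_i)$, and denote by $e_{i_1}\cdots e_{i_r}$ the pointwise product of functions (the empty product is the constant function $1$). A hat $\widehat{e}_{i_k}$ means that the factor is omitted. $T_{a_j}$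 is the $q$-shift operator $a_j\to qa_j$ (that is, $\alpha_j\to\alpha_j+1$), acting on functions of the parameters with all other parameters and $\xi$ fixed; it acts on vectors entrywise. Standing assumptions: all Jackson integrals occurring in the statement (including the shifted ones) converge (in particular no lattice point $q^\nu\xi$ is a pole of $\Phi$), and the parameters are generic: the $a_i$ are pairwise distinct and all denominators occurring in the statement are nonzero. *)

(* Defs.v *)
From HB Require Import structures.
From mathcomp Require Import all_boot all_order all_algebra.
From mathcomp Require Import all_classical all_reals all_analysis.
From mathcomp Require Import complex.

Set Implicit Arguments.
Unset Strict Implicit.
Unset Printing Implicit Defensive.

Import Order.TTheory GRing.Theory Num.Theory.
Import numFieldNormedType.Exports.

Local Open Scope classical_set_scope.
Local Open Scope ring_scope.
Local Open Scope complex_scope.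

(* R[i] seen as a numClosedFieldType, from which it inherits its topology. *)
Definition cplx (R : realType) : numClosedFieldType := R[i].

Definition expC (R : realType) (z : cplx R) : cplx R :=
  (expR (complex.Re z) * cos (complex.Im z)) +i*
  (expR (complex.Re z) * sin (complex.Im z)).

(* The power z ^ c for the branch given by a logarithm logz of z. *)
Definition powC (R : realType) (logz c : cplx R) : cplx R := expC (c * logz).

(* q ^ al, with the real logarithm of q. *)
Definition qpow (R : realType) (q : R) (al : cplx R) : cplx R :=
  powC (ln q)%:C al.

(* (x)_oo = \prod_(i >= 0) (1 - q ^ i x) *)
Definition qpoch (R : realType) (q : R) (x : cplx R) : cplx R :=
  limn (fun n : nat => \prod_(0 <= i < n) (1 - (q ^+ i)%:C * x) : cplx R).

(* A bilateral series converges when both of its halves, over nu >= 0 and over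
   nu < 0, converge (Negz k is the integer - (k + 1)). *)
Definition bicvg (R : realType) (u : int -> cplx R) : Prop :=
  cvgn (series (fun k : nat => u (Posz k))) /\
  cvgn (series (fun k : nat => u (Negz k))).

Definition bisum (R : realType) (u : int -> cplx R) : cplx R :=
  limn (series (fun k : nat => u (Posz k))) +
  limn (series (fun k : nat => u (Negz k))).

Section Jackson.
Variables (R : realType) (q : R) (N : nat).
Local Notation C := (cplx R).
Implicit Types (al : 'I_N -> C) (phi : C -> C) (z logz xi logxi : C).

Definition par al (m : 'I_N) : C := qpow q (al m).

(* Phi is multivalued in z: the branch is the one given by logz. *)
Definition Phi al z logz : C :=
  \prod_(m < N) (powC logz (2^-1 - al m) *
    (qpoch q (q%:C * z / par al m) / qpoch q (par al m * z))).

Definition Delta z : C := z^-1 - z.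

Definition latt xi (nu : int) : C := (q ^ nu)%:C * xi.

(* With these logarithms, (q ^ nu xi) ^ c = q ^ (c nu) xi ^ c. *)
Definition loglatt logxi (nu : int) : C := (nu%:~R * ln q)%:C + logxi.

Definition jackson_term al xi logxi phi (nu : int) : C :=
  phi (latt xi nu) * Phi al (latt xi nu) (loglatt logxi nu) *
  Delta (latt xi nu).

Definition jackson al xi logxi phi : C :=
  (1 - q%:C) * bisum (jackson_term al xi logxi phi).

(* The poles of Phi are the zeros of its denominator. *)
Definition jackson_cvg al xi logxi phi : Prop :=
  (forall (m : 'I_N) (nu : int), qpoch q (par al m * latt xi nu) != 0) /\
  bicvg (jackson_term al xi logxi phi).

Definition qshift (T : Type) (j : 'I_N) (F : ('I_N -> C) -> T) : ('I_N -> C) -> T :=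
  fun al => F (fun m => al m + (m == j)%:R).

End Jackson.

Definition e (R : realType) (x y : cplx R) : cplx R :=
  x + x^-1 - (y + y^-1).

Section System.
(* s = n + 1 *)
Variables (R : realType) (n : nat).
Local Notation C := (cplx R).
Local Notation N := (2 * n.+1 + 2)%N.
Variables (a : 'I_N -> C) (i : 'I_n -> 'I_N) (j : 'I_N).

Definition v (k : 'I_n.+1) : C -> C := fun z =>
  if unlift ord0 k is Some k' then \prod_(l < n | l != k') e z (a (i l))
  else \prod_(l < n) e z (a (i l)).

Definition c0_num : C := \prod_m (1 - a j * a m).
Definition c0_den : C :=
  (- a j) ^+ n.+1 * (1 - \prod_m a m) * (1 - a j ^+ 2)
  * \prod_(l < n) e (a (i l)) (a j).
Definition c0 : C := c0_num / c0_den.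

Definition c (k : 'I_n) : C := e (a (i k)) (a j).

Definition d_num (k : 'I_n) : C := \prod_m (1 - a (i k) * a m).
Definition d_den (k : 'I_n) : C :=
  (- a (i k)) ^+ n.+1 * (1 - \prod_m a m) * (1 - a (i k) ^+ 2)
  * e (a j) (a (i k)) * \prod_(l < n | l != k) e (a (i l)) (a (i k)).
Definition d (k : 'I_n) : C := d_num k / d_den k.

Definition U : 'M[C]_(1 + n) :=
  block_mx c0%:M (const_mx 1) 0 (diag_mx (\row_k c k)).

Definition L : 'M[C]_(1 + n) :=
  block_mx 1%:M 0 (\col_k d k) 1%:M.

Definition B : 'M[C]_n.+1 := U *m L.

End System.

Section JacksonVector.
Variables (R : realType) (q : R) (n : nat).
Local Notation N := (2 * n.+1 + 2)%N.

Definition jackson_vec (xi logxi : cplx R) (i : 'I_n -> 'I_N)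
    (al : 'I_N -> cplx R) : 'rV[cplx R]_n.+1 :=
  \row_k jackson q al xi logxi (v (par q al) i k).

Definition jackson_vec_cvg (xi logxi : cplx R) (i : 'I_n -> 'I_N)
    (al : 'I_N -> cplx R) : Prop :=
  forall k, jackson_cvg q al xi logxi (v (par q al) i k).

End JacksonVector.

(* Main.v *)
Require Import Defs.
From mathcomp Require Import all_boot all_order all_algebra.
From mathcomp Require Import all_classical all_reals all_analysis.
From mathcomp Require Import complex ring lra zify.
Set Implicit Arguments.
Unset Strict Implicit.
Unset Printing Implicit Defensive.
Import Order.TTheory GRing.Theory Num.Theory.
Import numFieldNormedType.Exports.
Local Open Scope classical_set_scope.
Local Open Scope ring_scope.
Local Open Scope complex_scope.

(** Shifting a_j and the columns k >= 1 of the system are pointwise identities.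
    Raising alpha_j by one multiplies Phi(z) by e(z;a_j), so that
    T_{a_j}<phi,xi> = <e_j phi,xi> for every phi free of a_j
    ([jackson_term_shift]); and e_j = e_{i_k} + e(a_{i_k};a_j) turns e_j v_k into
    v_0 + c_k v_k ([e_mul_vlift]).

    What remains is to expand <e_j v_0,xi>, an integral of a product of s factors
    e(z;x_k) with nodes x = (a_j, a_{i_1}, ..., a_{i_{s-1}}), over the integrals
    in which one factor is omitted ([jackson_contiguity]).  This relation comes
    from a telescoping sum.  Put b(z) = prod_m (a_m - z) / z^(s+1).  The
    quasi-periodicity of Phi gives b(qz) Phi(qz) = b(1/z) Phi(z)
    ([Phi_shift_lattice]), so (b(z) - b(1/z)) Phi(z) is a difference of
    consecutive values of b Phi along the lattice.  The function b(z) - b(1/z) is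
    antisymmetric, hence is Delta(z) times a symmetric Laurent polynomial of
    degree s; its coefficients over the products of e(z;x_k) are found by
    evaluating at the nodes, where b vanishes ([boundary_antisym]).  The top
    coefficient is -(1 - a_1...a_{2s+2}), and dividing by it produces exactly
    c_0 and the d_k.

    The telescoping sum is zero because b Phi tends to 0 at both ends of the
    lattice: the terms of the convergent series <e_j v_0,xi> tend to 0, and b Phi
    is such a term times a rational function of z at one end, of 1/z at the
    other, which is regular at 0 ([cvg0_rational]).

    The infinite products (x)_oo enter only through (x)_oo = (1 - x)(qx)_oo
    ([qpochS]), which rests on their convergence in the complex numbers
    ([cvg_qpoch]). *)

(** * The complex exponential and the q-shifted factorial *)

Lemma expCD (R : realType) (x y : cplx R) : expC (x + y) = expC x * expC y.
Proof.
case: x => a b; case: y => c d; rewrite /expC /=.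
by rewrite expRD cosD sinD; simpc; congr (_ +i* _); ring.
Qed.

Lemma expC_real (R : realType) (x : R) : expC (x%:C : cplx R) = (expR x)%:C.
Proof. by rewrite /expC /= cos0 sin0 mulr1 mulr0. Qed.

Lemma expC0 (R : realType) : expC (0 : cplx R) = 1.
Proof. by rewrite (expC_real 0) expR0. Qed.

Lemma expC_neq0 (R : realType) (x : cplx R) : expC x != 0.
Proof.
apply/eqP => x0; have := expC0 R.
by rewrite -(subrr x) expCD x0 mul0r => /eqP; rewrite eq_sym oner_eq0.
Qed.

Lemma expCN (R : realType) (x : cplx R) : expC (- x) = (expC x)^-1.
Proof.
by apply: (mulfI (expC_neq0 x)); rewrite -expCD subrr expC0 mulfV ?expC_neq0.
Qed.

Lemma expR_int_ln (R : realType) (q : R) (nu : int) : 0 < q ->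
  expR (nu%:~R * ln q) = q ^ nu.
Proof.
move=> q0; have qK : expR (ln q) = q by apply: lnK.
case: nu => k; first by rewrite expRM_natl qK.
by rewrite NegzE mulrNz mulNr expRN expRM_natl qK.
Qed.

Lemma normc_le (R : realType) (a b : R) :
  `| (a +i* b : cplx R) | <= (`|a| + `|b|)%:C.
Proof.
rewrite (complexE (a +i* b)) /=; apply: (le_trans (ler_normD _ _)).
rewrite normrM rmorphD /= lerD //.
  by rewrite normc_def /= expr0n addr0 sqrtr_sqr.
by rewrite !normc_def /= !expr0n /= add0r addr0 expr1n sqrtr1 mul1r sqrtr_sqr.
Qed.

Lemma cvg_complex (R : realType) (u v : nat -> R) (a b : R) :
  u n @[n --> \oo] --> a -> v n @[n --> \oo] --> b ->
  (u n +i* v n : cplx R) @[n --> \oo] --> (a +i* b : cplx R).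
Proof.
move=> /cvgrPdist_lt ua /cvgrPdist_lt vb; apply/cvgrPdist_lt => eps eps0.
have [r epsE] : exists r : R, eps = r%:C.
  by apply/complex_realP; rewrite realE ltW.
move: eps0; rewrite epsE (_ : 0 = 0%:C) // ltcR => r0.
have r20 : 0 < r / 2 by lra.
near=> n.
have -> : (a +i* b : cplx R) - (u n +i* v n) = (a - u n) +i* (b - v n) by simpc.
apply: (le_lt_trans (normc_le _ _)); rewrite ltcR.
have h1 : `|a - u n| < r / 2 by near: n; exact: ua.
have h2 : `|b - v n| < r / 2 by near: n; exact: vb.
lra.
Unshelve. all: end_near. Qed.

Lemma Re_ler_norm (R : realType) (z : cplx R) :
  `|complex.Re z| <= complex.Re `|z|.
Proof. by have := normc_ge_Re z; rewrite lecE => /andP[]. Qed.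

Lemma Im_ler_norm (R : realType) (z : cplx R) :
  `|complex.Im z| <= complex.Re `|z|.
Proof.
have -> : complex.Im z = - complex.Re (z * 'i%C) by case: z => a b; simpc.
have -> : `|z| = `|z * 'i%C|.
  by rewrite normrM [`|'i%C|]normc_def /= expr0n add0r expr1n sqrtr1 mulr1.
by rewrite normrN Re_ler_norm.
Qed.

(** The real and imaginary parts are absolutely convergent real series, so the
    completeness of the reals is enough. *)
Lemma cvg_series_complex (R : realType) (u : nat -> cplx R) (w : nat -> R) :
  (forall n, `|u n| <= (w n)%:C) -> cvgn (series w) -> cvgn (series u).
Proof.
move=> uw cw.
have w0 n : 0 <= w n by rewrite -ler0c (le_trans _ (uw n)).
have wle n : complex.Re `|u n| <= w n by have := uw n; rewrite lecE => /andP[].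
have real_cvg (f : nat -> R) : (forall n, `|f n| <= w n) -> cvgn (series f).
  by move=> fw; apply: normed_cvg; apply: series_le_cvg cw => n; rewrite /= ?fw.
have cR : cvgn (series (fun n => complex.Re (u n))).
  by apply: real_cvg => n; exact: le_trans (Re_ler_norm _) (wle n).
have cI : cvgn (series (fun n => complex.Im (u n))).
  by apply: real_cvg => n; exact: le_trans (Im_ler_norm _) (wle n).
have /cvgP := cvg_complex cR cI.
suff -> : series u = (fun n => series (fun n => complex.Re (u n)) n +i*
  series (fun n => complex.Im (u n)) n) by [].
apply/funext => n; rewrite /series /=.
elim: n => [|n IHn]; first by rewrite !big_nil.
by rewrite !big_nat_recr //= IHn; case: (u n) => a b; simpc.
Qed.

(** The partial products P_n are bounded by exp(|x| / (1 - q)), so that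
    P_{n+1} - P_n = - P_n q^n x is dominated by a geometric sequence. *)
Lemma cvg_qpoch (R : realType) (q : R) (q0 : 0 < q) (q1 : q < 1) (x : cplx R) :
  cvgn (fun n : nat => \prod_(0 <= i < n) (1 - (q ^+ i)%:C * x) : cplx R).
Proof.
set P : nat -> cplx R := (fun n : nat => _).
have qN1 : `|q| < 1 by rewrite ger0_norm // ltW.
have q1N : 0 < 1 - q by rewrite subr_gt0.
have [r xr] : exists r : R, `|x| = r%:C by eexists; exact: normc_def.
have r0 : 0 <= r by rewrite -ler0c -xr.
have normqx k : `|(q ^+ k)%:C * x| = (r * q ^+ k)%:C.
  rewrite normrM xr rmorphM /= mulrC; congr (_ * _).
  by rewrite ger0_norm // ler0c exprn_ge0 // ltW.
have sum_le n : \sum_(0 <= i < n) r * q ^+ i <= r / (1 - q).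
  rewrite -mulr_sumr ler_wpM2l // big_mkord -(ler_pM2l q1N) mulfV ?gt_eqF //.
  by rewrite -opprB mulNr -subrX1 opprB lerBlDr lerDl exprn_ge0 // ltW.
have bound n : `|P n| <= (expR (r / (1 - q)))%:C.
  apply: (@le_trans _ _ (expR (\sum_(0 <= i < n) r * q ^+ i))%:C); last first.
    by rewrite lecR ler_expR.
  rewrite {}/P; elim: n => [|n IHn]; first by rewrite !big_nil normr1 expR0.
  rewrite !big_nat_recr //= normrM expRD rmorphM /= ler_pM //.
  apply: (le_trans (ler_normB _ _)); rewrite normr1 normqx -(rmorphD _ 1) lecR.
  exact: expR_ge1Dx.
have : cvgn (series (fun n => P n.+1 - P n)).
  apply: (@cvg_series_complex _ _ (geometric (expR (r / (1 - q)) * r) q)).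
    move=> n; rewrite /P big_nat_recr //= -/(P n) mulrBr mulr1 addrAC subrr.
    rewrite add0r normrN normrM normqx /= -mulrA [leRHS]rmorphM ler_pM //.
    by rewrite ler0c mulr_ge0 // exprn_ge0 // ltW.
  exact: is_cvg_geometric_series.
move=> /cvg_ex[l cl]; apply/cvg_ex; exists (l + 1).
have -> : P = series (fun n => P n.+1 - P n) \+ cst 1.
  apply/funext => n /=; rewrite /series /= telescope_sumr //.
  by rewrite (_ : P 0%N = 1) ?subrK // /P big_geq.
by apply: cvgD cl _; exact: cvg_cst.
Qed.

Lemma qpochS (R : realType) (q : R) (q0 : 0 < q) (q1 : q < 1) (x : cplx R) :
  qpoch q x = (1 - x) * qpoch q (q%:C * x).
Proof.
rewrite /qpoch.
have cx := @cvg_qpoch _ q q0 q1 x; have cqx := @cvg_qpoch _ q q0 q1 (q%:C * x).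
apply: (@cvg_lim _ (@norm_hausdorff _ _)); rewrite -cvg_shiftS /=.
have -> : (fun n => \prod_(0 <= i < n.+1) (1 - (q ^+ i)%:C * x) : cplx R) =
    cst (1 - x) \*
    (fun n => \prod_(0 <= i < n) (1 - (q ^+ i)%:C * (q%:C * x)) : cplx R).
  apply/funext => n /=; rewrite big_nat_recl //= expr0 mul1r; congr (_ * _).
  by apply: eq_bigr => i _; rewrite exprSr rmorphM mulrA.
by apply: cvgM cqx; exact: cvg_cst.
Qed.

(** * Interpolation of an antisymmetric Laurent polynomial *)

Lemma size_prod_bound (F : idomainType) (I : finType) (P : pred I)
    (p : I -> {poly F}) (d : nat) :
  (forall i, size (p i) <= d.+1)%N ->
  (size (\prod_(i | P i) p i)%R <= (#|P| * d).+1)%N.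
Proof.
move=> hp; apply: (leq_trans (size_prod_leq _ _)).
have : (\sum_(i | P i) size (p i) <= \sum_(i | P i) d.+1)%N.
  by apply: leq_sum => i _.
rewrite sum_nat_const; move: (\sum_(i | _) _)%N => t; lia.
Qed.

(** The polynomial avatar z e(z;y) of e(z;y). *)
Definition root_pair (R : realType) (y : cplx R) : {poly cplx R} :=
  ('X - y%:P) * ('X - y^-1%:P).

Lemma horner_root_pair (R : realType) (y z : cplx R) : z != 0 -> y != 0 ->
  (root_pair y).[z] = z * e z y.
Proof. by move=> z0 y0; rewrite /root_pair /e !hornerE; field; rewrite z0 y0. Qed.

Section Interpolation.
Variables (R : realType) (s : nat).
Local Notation C := (cplx R).
Variables (a : 'I_(2 * s + 2) -> C) (x : 'I_s -> C).

(** The function b for which b Phi telescopes along the lattice. *)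
Definition boundary (z : C) : C := \prod_m (a m - z) / z ^+ s.+1.

Definition interp_coef (k : 'I_s) : C :=
  \prod_m (1 - x k * a m) /
  ((- x k) ^+ s * (1 - x k ^+ 2) * \prod_(l < s | l != k) e (x l) (x k)).

Definition interp (z : C) : C :=
  - (1 - \prod_m a m) * \prod_k e z (x k)
  + \sum_k interp_coef k * \prod_(l < s | l != k) e z (x l).

Lemma e_diag (y : C) : e y y = 0.
Proof. exact: subrr. Qed.

Lemma e_inv (z y : C) : e z^-1 y = e z y.
Proof. by rewrite /e invrK [z^-1 + z]addrC. Qed.

Lemma interpV (z : C) : interp z^-1 = interp z.
Proof.
rewrite /interp; congr (_ * _ + _); apply: eq_bigr => k _; rewrite ?e_inv //.
by congr (_ * _); apply: eq_bigr => l _; rewrite e_inv.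
Qed.

(** The number of parameters is even, so no sign appears. *)
Lemma boundaryV (z : C) : z != 0 -> boundary z^-1 = \prod_m (1 - a m * z) / z ^+ s.+1.
Proof.
move=> z0; rewrite /boundary.
have -> : \prod_m (a m - z^-1) = \prod_m ((- z^-1) * (1 - a m * z)).
  by apply: eq_bigr => m _; field.
have even_pow : (- z^-1) ^+ (2 * s + 2) = (z ^+ s.+1 * z ^+ s.+1)^-1.
  rewrite (_ : 2 * s + 2 = 2 * s.+1)%N; last lia.
  by rewrite exprM sqrrN -exprM mulnC exprM expr2 exprVn -invfM.
rewrite big_split /= prodr_const card_ord even_pow exprVn.
have := expf_neq0 s.+1 z0; move: (z ^+ s.+1) => y y0.
by field.
Qed.

Hypothesis x_neq0 : forall k, x k != 0.
Hypothesis x2_neq1 : forall k, 1 - x k ^+ 2 != 0.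
Hypothesis x_sep : forall k l, l != k -> e (x l) (x k) != 0.
Hypothesis x_mem : forall k, exists m, a m = x k.

Let defect (z : C) : C := boundary z - boundary z^-1 - Delta z * interp z.

Let defectV z : defect z^-1 = - defect z.
Proof.
by rewrite /defect /Delta interpV invrK; ring.
Qed.

(** At a node b vanishes, and in [interp] only the summand that omits
    this node survives; [interp_coef] is chosen to make the two sides agree. *)
Let defect_x k : defect (x k) = 0.
Proof.
have x0 := x_neq0 k; have x2 := x2_neq1 k.
rewrite /defect boundaryV // /interp /boundary.
have [m am] := x_mem k.
rewrite (bigD1 m) //= am subrr !mul0r sub0r.
rewrite (bigD1 k) //= e_diag mul0r mulr0 add0r.
rewrite (bigD1 k) //= [X in _ * (_ + X)]big1 ?addr0; last first.
  by move=> l lk; rewrite (bigD1 k) 1?eq_sym //= e_diag mul0r mulr0.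
have -> : \prod_(l < s | l != k) e (x k) (x l) =
    (-1) ^+ s.-1 * \prod_(l < s | l != k) e (x l) (x k).
  rewrite -[X in _ ^+ X.-1](card_ord s) -(cardC1 k) -prodr_const -big_split /=.
  by apply: eq_bigr => l _; rewrite /e; ring.
rewrite /interp_coef.
under eq_bigr do rewrite mulrC.
move: (\prod_(m < _) _) => p.
have: \prod_(l < s | l != k) e (x l) (x k) != 0.
  by apply/prodf_neq0 => l; apply: x_sep.
move: (\prod_(l < _ | _) _) => E E0.
rewrite (_ : s = s.-1.+1) /=; last by rewrite prednK //; case: (k) => ? /=; lia.
rewrite /Delta [(- x k) ^+ _]exprNn [(-1) ^+ _.+1]exprS.
have: (-1 : C) ^+ s.-1 != 0 by rewrite signr_eq0.
move: ((-1 : C) ^+ s.-1) => sg sg0.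
rewrite !exprS; have := expf_neq0 s.-1 x0; move: (x k ^+ s.-1) => y y0.
by field; rewrite sg0 y0 x0 E0 x2.
Qed.

Let w (k : 'I_s) : {poly C} := root_pair (x k).
(** z ^ (s+1) times the defect, written as a polynomial. *)
Let D : {poly C} :=
  \prod_m ((a m)%:P - 'X) - \prod_m (1 - (a m)%:P * 'X)
  - (1 - 'X^2) * ((- (1 - \prod_m a m))%:P * \prod_k w k
      + \sum_k (interp_coef k)%:P * ('X * \prod_(l < s | l != k) w l)).

Let prod_w (P : pred 'I_s) z : z != 0 ->
  \prod_(k | P k) (w k).[z] = z ^+ #|P| * \prod_(k | P k) e z (x k).
Proof.
move=> z0; rewrite -prodr_const -big_split /=.
by apply: eq_bigr => k _; rewrite horner_root_pair.
Qed.

Let D_horner z : z != 0 -> D.[z] = z ^+ s.+1 * defect z.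
Proof.
move=> z0; rewrite /D /defect boundaryV // /boundary /interp.
rewrite !(hornerD, hornerN) hornerM !(hornerD, hornerN) hornerXn hornerM !hornerC.
rewrite !horner_prod horner_sum.
under eq_bigr do rewrite !hornerE.
under [X in _ - X - _]eq_bigr do rewrite !hornerE.
have -> : \prod_k (w k).[z] = z ^+ s * \prod_k e z (x k).
  by rewrite prod_w // card_ord.
have -> : \sum_k ((interp_coef k)%:P * ('X * \prod_(l < s | l != k) w l)).[z] =
    z ^+ s * \sum_k interp_coef k * \prod_(l < s | l != k) e z (x l).
  rewrite mulr_sumr; apply: eq_bigr => k _.
  rewrite !hornerM hornerC hornerX horner_prod prod_w // [z * _]mulrA -exprS.
  rewrite mulrCA; congr (_ ^+ _ * _).
  have := cardC1 k; rewrite card_ord => ->.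
  by rewrite prednK //; case: (k) => ? /=; lia.
rewrite /Delta [z ^+ s.+1]exprS; have := expf_neq0 s z0; move: (z ^+ s) => y y0.
by field; rewrite y0 z0.
Qed.

Let D_root0 : D.[0] = 0.
Proof.
rewrite /D !(hornerD, hornerN) hornerM !(hornerD, hornerN) hornerXn hornerM !hornerC.
rewrite !horner_prod horner_sum.
have -> : \prod_m ((a m)%:P - 'X).[0] = \prod_m a m.
  by apply: eq_bigr => m _; rewrite !hornerE subr0.
rewrite [\prod_m (1 - (a m)%:P * 'X).[0]]big1 => [|m _]; last first.
  by rewrite !hornerE ?mulr0 ?subr0.
rewrite [\prod_k (w k).[0]]big1 => [|k _]; last first.
  by rewrite /w /root_pair !hornerE ?sub0r mulrNN mulfV.
rewrite [\sum_k _]big1 => [|k _]; last by rewrite !(hornerM, hornerX, mul0r, mulr0).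
by rewrite expr0n /=; ring.
Qed.

Let D_size : (size D <= 2 * s + 3)%N.
Proof.
have w2 k : (size (w k) <= 3)%N.
  by rewrite (leq_trans (size_mul_leq _ _)) // !size_XsubC.
have N2 : (2 * s + 2 <= 2 * s + 3)%N by lia.
rewrite /D (leq_trans (size_polyD _ _)) // size_polyN geq_max; apply/andP; split.
  rewrite (leq_trans (size_polyD _ _)) // size_polyN geq_max; apply/andP; split.
    apply: (leq_trans (size_prod_bound (d := 1) predT _)) => [m|].
      rewrite (leq_trans (size_polyD _ _)) // size_polyN size_polyX geq_max.
      by rewrite (leq_trans (size_polyC_leq1 _)).
    by rewrite card_ord; lia.
  apply: (leq_trans (size_prod_bound (d := 1) predT _)) => [m|].
    rewrite (leq_trans (size_polyD _ _)) // size_polyN size_poly1 geq_max /=.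
    by rewrite mul_polyC (leq_trans (size_scale_leq _ _)) ?size_polyX.
  by rewrite card_ord; lia.
have inner : (size ((- (1 - \prod_m a m))%:P * \prod_k w k
      + \sum_k (interp_coef k)%:P * ('X * \prod_(l < s | l != k) w l))%R <= 2 * s + 1)%N.
  rewrite (leq_trans (size_polyD _ _)) // geq_max; apply/andP; split.
    rewrite mul_polyC (leq_trans (size_scale_leq _ _)) //.
    by apply: (leq_trans (size_prod_bound predT w2)); rewrite card_ord; lia.
  apply: (leq_trans (size_sum _ _ _)); apply/bigmax_leqP => k _.
  rewrite mul_polyC (leq_trans (size_scale_leq _ _)) //.
  rewrite (leq_trans (size_mul_leq _ _)) // size_polyX /=.
  have k0 := ltn_ord k.
  have := size_prod_bound (fun l => l != k) w2.
  by rewrite (cardC1 k) card_ord; move: (size _) => t; lia.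
apply: (leq_trans (size_mul_leq _ _)).
have : (size (1 - 'X^2 : {poly C})%R <= 3)%N.
  by rewrite (leq_trans (size_polyD _ _)) // size_polyN size_polyXn size_poly1.
move: inner; move: (size _) => t; move: (size _) => t'; lia.
Qed.

(** The degree is at most 2s+2, and there are 2s+3 roots: 0, the two fixed
    points 1 and -1 of z |-> 1/z, and the nodes with their inverses. *)
Let D_eq0 : D = 0.
Proof.
pose rs := [:: 0; 1; -1] ++ [seq x k | k <- enum 'I_s]
             ++ [seq (x k)^-1 | k <- enum 'I_s].
have szrs : size rs = (2 * s + 3)%N.
  by rewrite !size_cat !size_map -!enumT size_enum_ord /=; lia.
apply/eqP; apply: contraT => D0.
have fixed0 z : z^-1 = z -> defect z = 0.
  move=> zV; have : defect z *+ 2 == 0 by rewrite mulr2n -{2}zV defectV subrr.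
  by rewrite mulrn_eq0 => /eqP.
have /(max_poly_roots D0) : all (root D) rs.
  rewrite /rs /= !all_cat; apply/and5P; split.
  - by apply/eqP; exact: D_root0.
  - by apply/eqP; rewrite D_horner ?oner_neq0 // fixed0 ?invr1 ?mulr0.
  - by apply/eqP; rewrite D_horner ?oppr_eq0 ?oner_neq0 // fixed0 ?invrN1 ?mulr0.
  - apply/allP => _ /mapP[k _ ->]; apply/eqP.
    by rewrite D_horner // defect_x mulr0.
  - apply/allP => _ /mapP[k _ ->]; apply/eqP.
    by rewrite D_horner ?invr_eq0 // defectV defect_x oppr0 mulr0.
rewrite szrs ltnNge D_size; apply.
have x_inj : injective x.
  move=> k l xkl; apply/eqP; apply: contraT => kl.
  by have := x_sep kl; rewrite xkl e_diag eqxx.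
have xN1 k : x k != 1.
  by apply/eqP => x1; have := x2_neq1 k; rewrite x1 expr1n subrr eqxx.
have xNN1 k : x k != -1.
  by apply/eqP => x1; have := x2_neq1 k; rewrite x1 sqrrN expr1n subrr eqxx.
have xV k l : x k != (x l)^-1.
  apply/eqP => xkl; have [kl|kl] := eqVneq k l.
    by have := x2_neq1 k; rewrite expr2 {2}xkl kl mulfV ?subrr ?eqxx.
  by have := x_sep kl; rewrite xkl e_inv e_diag eqxx.
rewrite /rs cat_uniq; apply/and3P; split.
- rewrite /= !inE !negb_or andbT eq_sym oner_neq0 eq_sym oppr_eq0 oner_neq0 /=.
  by rewrite eq_sym eqNr oner_neq0.
- apply/hasPn => y; rewrite mem_cat => /orP[] /mapP[k _ ->].
    by rewrite !inE !negb_or x_neq0 xN1 xNN1.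
  rewrite !inE !negb_or invr_eq0 x_neq0 invr_eq1 xN1 /=.
  by rewrite -[-1]invrK invrN1 (inj_eq invr_inj) xNN1.
- rewrite cat_uniq; apply/and3P; split.
  + by rewrite map_inj_uniq ?enum_uniq.
  + apply/hasPn => _ /mapP[k _ ->]; apply/negP => /mapP[l _] /esym/eqP; exact/negP.
  + by rewrite (map_inj_uniq (inj_comp invr_inj x_inj)) enum_uniq.
Qed.

(** The coefficient of the full product is read off at z = 0, those of the
    products with one factor omitted at the nodes. *)
Lemma boundary_antisym (z : C) : z != 0 ->
  boundary z - boundary z^-1 = Delta z * interp z.
Proof.
move=> z0; apply/eqP; rewrite -subr_eq0 -/(defect z).
by have /esym/eqP := D_horner z0; rewrite D_eq0 horner0 mulf_eq0 expf_eq0 (negPf z0).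
Qed.
End Interpolation.

(** * Bilateral sums *)

Section BilateralSums.
Variable R : realType.
Local Notation C := (cplx R).
Implicit Types (u v h : int -> C) (l : C).

(** A relation, so that convergence and value are carried along together. *)
Definition has_bisum u l : Prop := exists l1 l2 : C,
  [/\ series (fun k => u (Posz k)) n @[n --> \oo] --> l1,
      series (fun k => u (Negz k)) n @[n --> \oo] --> l2 & l = l1 + l2].

Lemma bicvg_has_bisum u : bicvg u -> has_bisum u (bisum u).
Proof.
case=> cp cn; exists (limn (series (fun k => u (Posz k)))),
  (limn (series (fun k => u (Negz k)))).
by split; [exact: cp | exact: cn | exact: erefl].
Qed.

Lemma has_bisum_unique u l : has_bisum u l -> bisum u = l.
Proof.
move=> [l1 [l2 [c1 c2 ->]]]; rewrite /bisum.
by rewrite (cvg_lim (@norm_hausdorff _ _) c1) (cvg_lim (@norm_hausdorff _ _) c2).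
Qed.

Lemma has_bisum0 : has_bisum (fun _ => 0) 0.
Proof.
have c0 : series (fun _ : nat => 0 : C) n @[n --> \oo] --> (0 : C).
  have -> : series (fun _ : nat => 0 : C) = cst 0.
    by apply/funext => n; rewrite /series /= big1.
  exact: cvg_cst.
by exists 0, 0; rewrite addr0.
Qed.

Lemma has_bisumD u v l m : has_bisum u l -> has_bisum v m ->
  has_bisum (fun nu => u nu + v nu) (l + m).
Proof.
move=> [l1 [l2 [c1 c2 ->]]] [m1 [m2 [d1 d2 ->]]]; exists (l1 + m1), (l2 + m2).
split; last by rewrite addrACA.
  rewrite (_ : series _ = series (fun k => u (Posz k)) \+ series (fun k => v (Posz k))).
    exact: cvgD c1 d1.
  by apply/funext => n; rewrite /series /= big_split.
rewrite (_ : series _ = series (fun k => u (Negz k)) \+ series (fun k => v (Negz k))).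
  exact: cvgD c2 d2.
by apply/funext => n; rewrite /series /= big_split.
Qed.

Lemma has_bisumZ c u l : has_bisum u l -> has_bisum (fun nu => c * u nu) (c * l).
Proof.
move=> [l1 [l2 [c1 c2 ->]]]; exists (c * l1), (c * l2).
split; last by rewrite mulrDr.
  rewrite (_ : series _ = cst c \* series (fun k => u (Posz k))).
    by apply: cvgM c1; exact: cvg_cst.
  by apply/funext => n; rewrite /series /= mulr_sumr.
rewrite (_ : series _ = cst c \* series (fun k => u (Negz k))).
  by apply: cvgM c2; exact: cvg_cst.
by apply/funext => n; rewrite /series /= mulr_sumr.
Qed.

Lemma has_bisum_sum (I : Type) (r : seq I) (u : I -> int -> C) (l : I -> C) :
  (forall k, has_bisum (u k) (l k)) ->
  has_bisum (fun nu => \sum_(k <- r) u k nu) (\sum_(k <- r) l k).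
Proof.
move=> ul; elim: r => [|k r IHr].
  rewrite big_nil; under eq_fun do rewrite big_nil; exact: has_bisum0.
by rewrite big_cons; under eq_fun do rewrite big_cons; exact: has_bisumD.
Qed.

Lemma has_bisum_telescope h :
  h (Posz n) @[n --> \oo] --> (0 : C) -> h (Negz n) @[n --> \oo] --> (0 : C) ->
  has_bisum (fun nu => h nu - h (nu + 1)) 0.
Proof.
move=> hp hn; exists (h 0), (- h 0); split; last by rewrite subrr.
- rewrite (_ : series _ = cst (h 0) \- (fun n => h (Posz n))).
    by rewrite -[X in _ --> X]subr0; apply: cvgB hp; exact: cvg_cst.
  apply/funext => n; rewrite /series /=.
  under eq_bigr => k _ do rewrite -[_ - _]opprB -PoszD addn1.
  by rewrite sumrN (telescope_sumr (fun k => h (Posz k))) // opprB.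
- rewrite (_ : series _ = (fun n => h (- Posz n)) \- cst (h 0)).
    rewrite -[X in _ --> X]sub0r; apply: cvgB; last exact: cvg_cst.
    by rewrite -cvg_shiftS /=; under eq_fun do rewrite -NegzE.
  apply/funext => n; rewrite /series /=.
  rewrite (eq_bigr (fun k => h (- Posz k.+1) - h (- Posz k))) => [|k _].
    by rewrite (telescope_sumr (fun k => h (- Posz k))) // oppr0.
  by rewrite NegzE; congr (_ - h _); lia.
Qed.

Lemma bicvg_cvg0 u : bicvg u ->
  u (Posz n) @[n --> \oo] --> (0 : C) /\ u (Negz n) @[n --> \oo] --> (0 : C).
Proof. by case=> /cvg_series_cvg_0 cp /cvg_series_cvg_0 cn. Qed.

Lemma cvg_horner (p : {poly C}) (z : nat -> C) l :
  z n @[n --> \oo] --> l -> p.[z n] @[n --> \oo] --> p.[l].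
Proof.
move=> zl; elim/poly_ind: p => [|p c IHp].
  by under eq_fun do rewrite horner0; rewrite horner0; exact: cvg_cst.
under eq_fun do rewrite hornerMXaddC; rewrite hornerMXaddC.
by apply: cvgD; [exact: cvgM IHp zl | exact: cvg_cst].
Qed.

(** Dividing by d is only possible eventually, where d(z_n) is close to the
    nonzero number d(0); stating the relation without division lets it hold for
    every n. *)
Lemma cvg0_rational (p d : {poly C}) (z t h : nat -> C) :
  d.[0] != 0 -> z n @[n --> \oo] --> (0 : C) -> t n @[n --> \oo] --> (0 : C) ->
  (forall n, h n * d.[z n] = p.[z n] * t n) -> h n @[n --> \oo] --> (0 : C).
Proof.
move=> d0 z0 t0 hd.
have cd := cvg_horner (p := d) z0.
have := cvgM (cvgM (cvg_horner (p := p) z0) t0) (cvgV d0 cd).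
rewrite mulr0 mul0r => lim0.
suff eq_h : {near \oo, (fun n => p.[z n] * t n * d.[z n]^-1) =1 h}.
  by move=> A /lim0; exact: (near_eq_cvg eq_h).
near=> n; rewrite -hd mulfK //.
by near: n; exact: cvgr_neq0 cd d0.
Unshelve. all: end_near. Qed.

End BilateralSums.

(** * The weight Phi along the lattice *)

Section JacksonIntegral.
Variables (R : realType) (q : R) (q0 : 0 < q) (q1 : q < 1).
Local Notation C := (cplx R).
Implicit Types (z logz : C).

Let qC0 : (q%:C : C) != 0.
Proof. by rewrite -[0]/(0%:C) (inj_eq (@complexI R)) gt_eqF. Qed.

Lemma qpow_neq0 (al : C) : qpow q al != 0.
Proof. exact: expC_neq0. Qed.

Lemma expC_lnq : expC ((ln q)%:C : C) = q%:C.
Proof. by rewrite expC_real lnK. Qed.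

Lemma qpowD1 (al : C) : qpow q (al + 1) = q%:C * qpow q al.
Proof. by rewrite /qpow /powC mulrDl mul1r expCD expC_lnq mulrC. Qed.

Lemma lattS (xi : C) (nu : int) : latt q xi (nu + 1) = q%:C * latt q xi nu.
Proof. by rewrite /latt expfzDr ?gt_eqF // expr1z [_ * q]mulrC rmorphM mulrA. Qed.

Lemma loglattS (logxi : C) (nu : int) :
  loglatt q logxi (nu + 1) = (ln q)%:C + loglatt q logxi nu.
Proof. by rewrite /loglatt intrD mulrDl mul1r rmorphD /= -addrA addrCA. Qed.

Lemma expC_loglatt (xi logxi : C) (nu : int) : expC logxi = xi ->
  expC (loglatt q logxi nu) = latt q xi nu.
Proof. by move=> <-; rewrite /loglatt expCD expC_real expR_int_ln. Qed.

Lemma latt_neq0 (xi : C) nu : xi != 0 -> latt q xi nu != 0.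
Proof.
move=> xi0; rewrite mulf_neq0 // -[0]/(0%:C) (inj_eq (@complexI R)).
by rewrite expfz_neq0 // gt_eqF.
Qed.

Lemma cvg_pow0 (c : C) : (fun n => (q ^+ n)%:C * c : C) n @[n --> \oo] --> (0 : C).
Proof.
have qN1 : `|q| < 1 by rewrite ger0_norm // ltW.
have c0 : (fun _ : nat => 0 : R) n @[n --> \oo] --> (0 : R) by exact: cvg_cst.
have cc : (fun _ : nat => c) n @[n --> \oo] --> c by exact: cvg_cst.
have c1 : (fun n => (q ^+ n)%:C : C) n @[n --> \oo] --> (0 : C).
  exact: cvg_complex (cvg_expr qN1) c0.
rewrite -[X in _ --> X](mul0r c).
exact: cvgM c1 cc.
Qed.

Lemma cvg_latt_pos (xi : C) : latt q xi (Posz n) @[n --> \oo] --> (0 : C).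
Proof. exact: cvg_pow0. Qed.

Lemma cvg_latt_neg (xi : C) : (latt q xi (Negz n))^-1 @[n --> \oo] --> (0 : C).
Proof.
have := cvg_pow0 (q%:C * xi^-1).
rewrite (_ : (fun n => _) = (fun n => (latt q xi (Negz n))^-1)) //.
apply/funext => n; rewrite /latt invfM mulrA -rmorphM -exprSr; congr (_ * _).
by rewrite -(fmorphV (real_complex R)) /= invrK.
Qed.

Section Weight.
Variables (s : nat) (al : 'I_(2 * s + 2) -> C).
Local Notation a := (par q al).

(** The shifted power contributes 1/z and the two shifted products contribute
    (1 - z/a_j)(1 - a_j z), which together make e(z;a_j). *)
Lemma Phi_shift_par (j : 'I_(2 * s + 2)) z logz : expC logz = z ->
  qpoch q (a j * z) != 0 ->
  Phi q (fun m => al m + (m == j)%:R) z logz = e z (a j) * Phi q al z logz.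
Proof.
move=> zE nopole; have z0 : z != 0 by rewrite -zE expC_neq0.
have aj0 : a j != 0 := qpow_neq0 _.
rewrite /Phi (bigD1 j isT) [in RHS](bigD1 j isT) [RHS]mulrA; congr (_ * _); last first.
  by apply: eq_bigr => m /negPf mj; rewrite /par mj addr0.
have -> : par q (fun m => al m + (m == j)%:R) j = q%:C * a j.
  by rewrite /par eqxx qpowD1.
rewrite eqxx (_ : 2^-1 - (al j + 1) = (2^-1 - al j) - 1); last by ring.
have -> : powC logz (2^-1 - al j - 1) = powC logz (2^-1 - al j) * z^-1.
  by rewrite /powC mulrBl mul1r expCD expCN zE.
have -> : q%:C * z / (q%:C * a j) = z / a j by field; rewrite aj0 qC0.
have -> : q%:C * z / a j = q%:C * (z / a j) by rewrite -mulrA.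
rewrite (qpochS q0 q1 (z / a j)) -[q%:C * a j * z]mulrA.
move: nopole; rewrite (qpochS q0 q1 (a j * z)) mulf_eq0 negb_or => /andP[f0 g0].
rewrite /e; move: (powC _ _) (qpoch q (q%:C * (z / _))) => p Q.
move: g0; move: (qpoch _ _) => Q' Q'0.
by field; rewrite aj0 z0 f0 Q'0.
Qed.

(** The factors a_m - qz of b(qz) absorb the factors 1 - qz/a_m by which the
    numerators of Phi(qz) fall short of those of Phi(z).  No division by
    1 - qz/a_m is made, so zeros of Phi on the lattice are harmless. *)
Lemma Phi_shift_lattice z logz : expC logz = z ->
  (forall m, qpoch q (a m * z) != 0) ->
  boundary a (q%:C * z) * Phi q al (q%:C * z) ((ln q)%:C + logz)
    = boundary a z^-1 * Phi q al z logz.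
Proof.
move=> zE nopole; have z0 : z != 0 by rewrite -zE expC_neq0.
rewrite boundaryV // /boundary /Phi mulrAC -big_split mulrAC -big_split /=.
(* Each of the 2s+2 factors contributes q^(1/2), and the product q^(s+1)
   cancels the one in (qz)^(s+1). *)
pose r : C := expC (2^-1 * (ln q)%:C).
have rr : r ^+ 2 = q%:C.
  rewrite expr2 -expCD -mulrDl (_ : 2^-1 + 2^-1 = 1) ?mul1r ?expC_lnq //.
  by field.
rewrite (eq_bigr (fun m => r * ((1 - a m * z) * (powC logz (2^-1 - al m) *
    (qpoch q (q%:C * z / a m) / qpoch q (a m * z)))))); last first.
  move=> m _; have am0 : a m != 0 := qpow_neq0 _.
  have -> : powC ((ln q)%:C + logz) (2^-1 - al m) =
      r / a m * powC logz (2^-1 - al m).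
    by rewrite /powC mulrDr expCD [(_ - _) * (ln q)%:C]mulrBl expCD expCN.
  rewrite (qpochS q0 q1 (q%:C * z / a m)).
  move: (nopole m); rewrite (qpochS q0 q1 (a m * z)) mulf_eq0 negb_or.
  move=> /andP[f0 g0].
  have -> : q%:C * (q%:C * z) / a m = q%:C * (q%:C * z / a m) by rewrite -!mulrA.
  have -> : a m * (q%:C * z) = q%:C * (a m * z) by ring.
  move: (powC _ _) (qpoch q (q%:C * (q%:C * z / _))) => p Q.
  move: g0; move: (qpoch _ _) => Q' Q'0.
  by field; rewrite am0 f0 Q'0.
rewrite big_split /= prodr_const card_ord.
have -> : r ^+ (2 * s + 2) = q%:C ^+ s.+1.
  by rewrite -rr -exprM; congr (_ ^+ _); lia.
rewrite exprMn; move: (\prod_(m < _) _) => p.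
have := expf_neq0 s.+1 z0; have := expf_neq0 s.+1 qC0.
move: (z ^+ s.+1) (_ ^+ s.+1) => zs qs qs0 zs0.
by field; rewrite zs0 qs0.
Qed.

End Weight.
End JacksonIntegral.

(** * The contiguity relation *)

Section Contiguity.
Variables (R : realType) (q : R) (q0 : 0 < q) (q1 : q < 1).
Local Notation C := (cplx R).
Variables (s : nat) (al : 'I_(2 * s + 2) -> C) (x : 'I_s -> C).
Variables (xi logxi : C).
Local Notation a := (par q al).
Local Notation A := (\prod_m a m).
Local Notation term := (jackson_term q al xi logxi).

Hypothesis xiE : expC logxi = xi.
Hypothesis nopole : forall m nu, qpoch q (a m * latt q xi nu) != 0.
Hypothesis x_neq0 : forall k, x k != 0.
Hypothesis x2_neq1 : forall k, 1 - x k ^+ 2 != 0.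
Hypothesis x_sep : forall k l, l != k -> e (x l) (x k) != 0.
Hypothesis x_mem : forall k, exists m, a m = x k.

Let full : C -> C := fun z => \prod_k e z (x k).
Let omit (k : 'I_s) : C -> C := fun z => \prod_(l < s | l != k) e z (x l).

Hypothesis full_cvg : bicvg (term full).
Hypothesis omit_cvg : forall k, bicvg (term (omit k)).

Let z nu := latt q xi nu.
Let z_neq0 nu : z nu != 0.
Proof. by apply: latt_neq0 => //; rewrite -xiE expC_neq0. Qed.

Let h nu : C := boundary a (z nu) * Phi q al (z nu) (loglatt q logxi nu).

Let h_step nu : h nu - h (nu + 1) =
  - (1 - A) * term full nu + \sum_k interp_coef a x k * term (omit k) nu.
Proof.
rewrite /h /z lattS // loglattS Phi_shift_lattice //; last exact: expC_loglatt.
rewrite -mulrBl (boundary_antisym x_neq0 x2_neq1 x_sep x_mem (z_neq0 nu)) /interp.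
rewrite mulrDr mulrDl; congr (_ + _).
  by rewrite /jackson_term /full; ring.
rewrite mulr_sumr mulr_suml; apply: eq_bigr => k _.
by rewrite /jackson_term /omit; ring.
Qed.

(** z ^ (s+1) Delta(z) prod_k e(z;x_k): the denominator of b / (Delta prod e). *)
Let den : {poly C} := (1 - 'X^2) * \prod_k root_pair (x k).

Let den0 : den.[0] != 0.
Proof.
rewrite /den hornerM hornerD hornerN hornerXn hornerC horner_prod big1 => [|k _].
  by rewrite expr0n subr0 mulr1 oner_neq0.
by rewrite /root_pair !hornerE ?sub0r mulrNN mulfV.
Qed.

Let den_horner y : y != 0 -> den.[y] = (1 - y ^+ 2) * (y ^+ s * full y).
Proof.
move=> y0; rewrite /den hornerM hornerD hornerN hornerXn hornerC horner_prod.
rewrite (eq_bigr (fun k => y * e y (x k))) => [|k _].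
  by rewrite big_split /= prodr_const card_ord.
by rewrite horner_root_pair.
Qed.

Let h_cvg_pos : h (Posz n) @[n --> \oo] --> (0 : C).
Proof.
have [t0 _] := bicvg_cvg0 full_cvg.
pose p : {poly C} := \prod_m ((a m)%:P - 'X).
apply: (cvg0_rational (p := p) den0 (cvg_latt_pos q0 q1 xi) t0) => n.
have zn := z_neq0 (Posz n); rewrite den_horner // /p horner_prod.
rewrite (eq_bigr (fun m => a m - latt q xi n)) => [|m _]; last by rewrite !hornerE.
rewrite /h /boundary /jackson_term /Delta -/(z n) exprS.
have := expf_neq0 s zn; move: (z n ^+ s) => zs zs0.
by field; rewrite zs0 zn.
Qed.

(** At this end z tends to infinity, and 1/z to 0; the symmetry of e and
    [boundaryV] rewrite everything in terms of 1/z. *)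
Let h_cvg_neg : h (Negz n) @[n --> \oo] --> (0 : C).
Proof.
have [_ t0] := bicvg_cvg0 full_cvg.
pose p : {poly C} := - \prod_m (1 - (a m)%:P * 'X).
apply: (cvg0_rational (p := p) den0 (cvg_latt_neg q0 q1 xi) t0) => n.
have zn := z_neq0 (Negz n); rewrite den_horner ?invr_eq0 // /p hornerN horner_prod.
rewrite (eq_bigr (fun m => 1 - a m * (latt q xi (Negz n))^-1)) => [|m _]; last first.
  by rewrite !hornerE.
rewrite /h -[z (Negz n)]invrK boundaryV ?invr_eq0 //.
have fullV : full (z (Negz n))^-1 = full (z (Negz n)).
  by apply: eq_bigr => k _; rewrite e_inv.
rewrite /jackson_term /Delta -/(z (Negz n)) invrK fullV exprS.
have zn' : (z (Negz n))^-1 != 0 by rewrite invr_eq0.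
have := expf_neq0 s zn'; move: ((z (Negz n))^-1 ^+ s) => zs zs0.
by field; rewrite zs0 zn.
Qed.

(** Sum [h_step] over the lattice: the left-hand side telescopes to 0. *)
Lemma jackson_contiguity :
  (1 - A) * jackson q al xi logxi full =
  \sum_k interp_coef a x k * jackson q al xi logxi (omit k).
Proof.
have tel := has_bisum_telescope h_cvg_pos h_cvg_neg.
have lin := has_bisumD (has_bisumZ (- (1 - A)) (bicvg_has_bisum full_cvg))
  (has_bisum_sum (index_enum _) (fun k =>
     has_bisumZ (interp_coef a x k) (bicvg_has_bisum (omit_cvg k)))).
have : 0 = - (1 - A) * bisum (term full) +
    \sum_k interp_coef a x k * bisum (term (omit k)).
  apply: etrans (esym (has_bisum_unique tel)) (etrans _ (has_bisum_unique lin)).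
  by congr bisum; apply/funext => nu; rewrite h_step.
move=> /esym/eqP; rewrite mulNr addrC subr_eq0 => /eqP eq0.
rewrite /jackson mulrCA -eq0 mulr_sumr.
by apply: eq_bigr => k _; rewrite mulrCA.
Qed.

End Contiguity.

(** * The q-difference system *)


Lemma row_mx_head_tail (T : Type) (n : nat) (V : 'rV[T]_n.+1) :
  V = row_mx (\row_(_ < 1) V 0 ord0) (\row_k V 0 (lift ord0 k)).
Proof.
apply/rowP => k; case: (unliftP ord0 k) => [k'|] ->.
  by rewrite -rshift1 [RHS]row_mxEr mxE rshift1.
have -> : ord0 = lshift n (ord0 : 'I_1) by apply: val_inj.
by rewrite [RHS]row_mxEl mxE.
Qed.

Section System.
Variables (R : realType) (q : R) (q0 : 0 < q) (q1 : q < 1).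
Local Notation C := (cplx R).

Lemma jackson_term_shift (s : nat) (al : 'I_(2 * s + 2) -> C) (j : 'I_(2 * s + 2))
    (xi logxi : C) (phi : C -> C) : expC logxi = xi ->
  (forall nu, qpoch q (par q al j * latt q xi nu) != 0) ->
  jackson_term q (fun m => al m + (m == j)%:R) xi logxi phi =
  jackson_term q al xi logxi (fun z => e z (par q al j) * phi z).
Proof.
move=> xiE nopole; apply/funext => nu; rewrite /jackson_term.
by rewrite (Phi_shift_par q0 q1 (expC_loglatt _ _ xiE)) //=; ring.
Qed.

Lemma jackson_linear (N : nat) (al : 'I_N -> C) (xi logxi c : C) (f g : C -> C) :
  bicvg (jackson_term q al xi logxi f) -> bicvg (jackson_term q al xi logxi g) ->
  jackson q al xi logxi (fun z => f z + c * g z) =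
  jackson q al xi logxi f + c * jackson q al xi logxi g.
Proof.
move=> cf cg; rewrite /jackson mulrCA -mulrDr; congr (_ * _).
rewrite -(has_bisum_unique
  (has_bisumD (bicvg_has_bisum cf) (has_bisumZ c (bicvg_has_bisum cg)))).
by congr bisum; apply/funext => nu; rewrite /jackson_term; ring.
Qed.

Lemma prod_omit0 (n : nat) (F : 'I_n.+1 -> C) :
  \prod_(l < n.+1 | l != ord0) F l = \prod_(l < n) F (lift ord0 l).
Proof. by rewrite big_mkcond big_ord_recl /= mul1r. Qed.

Lemma prod_omit_lift (n : nat) (F : 'I_n.+1 -> C) (k : 'I_n) :
  \prod_(l < n.+1 | l != lift ord0 k) F l =
  F ord0 * \prod_(l < n | l != k) F (lift ord0 l).
Proof.
rewrite big_mkcond big_ord_recl /=; congr (_ * _).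
by rewrite [RHS]big_mkcond; apply: eq_bigr => l _; rewrite (inj_eq lift_inj).
Qed.

Variables (n : nat) (a : 'I_(2 * n.+1 + 2) -> C) (i : 'I_n -> 'I_(2 * n.+1 + 2)).
Variable (j : 'I_(2 * n.+1 + 2)).

(** a_j comes first, so that omitting node 0 gives v_0 and omitting node k gives
    e_j v_k. *)
Definition node (k : 'I_n.+1) : C :=
  if unlift ord0 k is Some k' then a (i k') else a j.

Lemma node0 : node ord0 = a j.
Proof. by rewrite /node unlift_none. Qed.

Lemma node_lift k : node (lift ord0 k) = a (i k).
Proof. by rewrite /node liftK. Qed.

Lemma v0E : v a i ord0 = fun z => \prod_(l < n) e z (a (i l)).
Proof. by rewrite /v unlift_none. Qed.

Lemma vliftE k : v a i (lift ord0 k) = fun z => \prod_(l < n | l != k) e z (a (i l)).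
Proof. by rewrite /v liftK. Qed.

Lemma prod_node z : \prod_k e z (node k) = e z (a j) * v a i ord0 z.
Proof.
by rewrite big_ord_recl node0 v0E; under eq_bigr do rewrite node_lift.
Qed.

Lemma prod_node_omit0 z : \prod_(l | l != ord0) e z (node l) = v a i ord0 z.
Proof. by rewrite prod_omit0 v0E; under eq_bigr do rewrite node_lift. Qed.

Lemma prod_node_omit_lift k z : \prod_(l | l != lift ord0 k) e z (node l) =
  e z (a j) * v a i (lift ord0 k) z.
Proof.
by rewrite prod_omit_lift node0 vliftE; under eq_bigr do rewrite node_lift.
Qed.

(** e(z;a_j) = e(z;a_{i_k}) + e(a_{i_k};a_j), and the first summand restores the
    omitted factor. *)
Lemma e_mul_vlift k z :
  e z (a j) * v a i (lift ord0 k) z =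
  v a i ord0 z + c a i j k * v a i (lift ord0 k) z.
Proof.
rewrite v0E vliftE [\prod_(l < n) _](bigD1 k) //=; move: (\prod_(l < n | _) _) => p.
by rewrite /c /e; ring.
Qed.

Hypothesis A_neq1 : 1 - \prod_m a m != 0.

Let cancel_A (p u w E A1 : C) : A1 != 0 ->
  p / (u * w * E) = A1 * (p / (u * A1 * w * E)).
Proof.
move=> A10; rewrite (_ : u * A1 * w * E = A1 * (u * w * E)); last by ring.
by rewrite [in RHS]invfM mulrCA mulVKf.
Qed.

Lemma interp_coef_node0 : interp_coef a node ord0 = (1 - \prod_m a m) * c0 a i j.
Proof.
rewrite /interp_coef /c0 /c0_num /c0_den prod_omit0 node0 -cancel_A //.
by congr (_ / (_ * _)); apply: eq_bigr => l _; rewrite node_lift.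
Qed.

Lemma interp_coef_node_lift k :
  interp_coef a node (lift ord0 k) = (1 - \prod_m a m) * d a i j k.
Proof.
rewrite /interp_coef /d /d_num /d_den prod_omit_lift node0 node_lift.
rewrite -[_ * e (a j) _ * _]mulrA -cancel_A //.
by congr (_ / (_ * (_ * _))); apply: eq_bigr => l _; rewrite node_lift.
Qed.

(** By blocks: U replaces the tail of the row by the entries V_0 + c_k W_k of
    e_j v_k, and L adds d_k times these to the head. *)
Lemma row_mulUL (V : 'rV[C]_1) (W : 'rV[C]_n) :
  row_mx V W *m B a i j =
  row_mx (\row_(_ < 1) (c0 a i j * V 0 0 +
           \sum_k d a i j k * (V 0 0 + c a i j k * W 0 k)))
         (\row_k (V 0 0 + c a i j k * W 0 k)).
Proof.
transitivity (@mulmx _ 1 (1 + n) (1 + n)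
  (@mulmx _ 1 (1 + n) (1 + n) (row_mx V W) (U a i j)) (L a i j)).
  exact: mulmxA.
rewrite /U mul_row_block /L mul_row_block !mulmx0 !mulmx1 addr0 add0r.
have -> : V *m const_mx 1 + W *m diag_mx (\row_k c a i j k) =
    \row_k (V 0 0 + c a i j k * W 0 k).
  by apply/rowP => k; rewrite mul_mx_diag !mxE big_ord1 !mxE mulr1 mulrC.
suff -> : V *m (c0 a i j)%:M +
    (\row_k (V 0 0 + c a i j k * W 0 k)) *m (\col_k d a i j k) =
  \row_(_ < 1) (c0 a i j * V 0 0 +
    \sum_k d a i j k * (V 0 0 + c a i j k * W 0 k)) by [].
apply/rowP => k; rewrite !mxE !ord1 big_ord1 !mxE eqxx mulr1n mulrC.
by congr (_ + _); apply: eq_bigr => l _; rewrite !mxE mulrC.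
Qed.

Lemma mulUL_head (V : 'rV[C]_n.+1) : (V *m B a i j) 0 ord0 =
  c0 a i j * V 0 ord0 +
  \sum_k d a i j k * (V 0 ord0 + c a i j k * V 0 (lift ord0 k)).
Proof.
rewrite {1}[V]row_mx_head_tail row_mulUL.
have -> : ord0 = lshift n (ord0 : 'I_1) by apply: val_inj.
rewrite [LHS]row_mxEl !mxE; congr (_ + _).
by apply: eq_bigr => k _; rewrite !mxE.
Qed.

Lemma mulUL_tail (V : 'rV[C]_n.+1) k : (V *m B a i j) 0 (lift ord0 k) =
  V 0 ord0 + c a i j k * V 0 (lift ord0 k).
Proof.
rewrite {1}[V]row_mx_head_tail row_mulUL -rshift1.
by rewrite [LHS]row_mxEr !mxE rshift1.
Qed.

Lemma det_UL : \det (B a i j) = c0 a i j * \prod_k c a i j k.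
Proof.
have detU : \det (U a i j) = c0 a i j * \prod_k c a i j k.
  rewrite /U det_ublock det_scalar1 det_diag.
  by congr (_ * _); apply: eq_bigr => k _; rewrite mxE.
have detL : \det (L a i j) = 1 by rewrite /L det_lblock !det1 mulr1.
by apply: etrans (det_mulmx _ _) _; rewrite -[RHS]mulr1 -detU -detL.
Qed.
End System.

Theorem theorem4p1 (R : realType) (q : R) (hq0 : 0 < q) (hq1 : q < 1)
    (n : nat) (alpha : 'I_(2 * n.+1 + 2) -> cplx R)
    (xi logxi : cplx R) (hxi : expC logxi = xi)
    (i : 'I_n -> 'I_(2 * n.+1 + 2)) (hi : injective i)
    (j : 'I_(2 * n.+1 + 2)) (hj : forall k : 'I_n, j != i k)
    (a := par q alpha)
    (a_inj : injective a)
    (prod_a : \prod_m a m != 1)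
    (hc0 : c0_den a i j != 0)
    (hd : forall k : 'I_n, d_den a i j k != 0)
    (hcvg : jackson_vec_cvg q xi logxi i alpha)
    (hcvgT : qshift j (jackson_vec_cvg q xi logxi i) alpha) :
  qshift j (jackson_vec q xi logxi i) alpha
    = jackson_vec q xi logxi i alpha *m B a i j
  /\ \det (B a i j)
    = (\prod_m (1 - a j * a m))
      / ((- a j) ^+ n.+1 * (1 - \prod_m a m) * (1 - a j ^+ 2)).
Proof.
have A1 : 1 - \prod_m a m != 0 by rewrite subr_eq0 eq_sym.
move: (hc0); rewrite /c0_den !mulf_eq0 !negb_or => /andP[/andP[_ aj2] ej].
have {}ej l : e (a (i l)) (a j) != 0 by move/prodf_neq0: ej; apply.
have hd' k : [/\ 1 - a (i k) ^+ 2 != 0, e (a j) (a (i k)) != 0 &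
    forall l, l != k -> e (a (i l)) (a (i k)) != 0].
  move: (hd k); rewrite /d_den !mulf_eq0 !negb_or.
  move=> /andP[/andP[/andP[_ a2] ejk] /prodf_neq0 elk].
  by split=> // l lk; apply: elk.
split; last first.
  rewrite det_UL /c0 /c0_den invfM mulrA -mulrA.
  by rewrite [X in _ * X]mulVf ?mulr1 //; apply/prodf_neq0.
pose x := node a i j.
have x_neq0 k : x k != 0 by rewrite /x /node; case: unliftP => *; exact: qpow_neq0.
have x2_neq1 k : 1 - x k ^+ 2 != 0.
  by rewrite /x /node; case: unliftP => // k' _; case: (hd' k').
have x_sep k l : l != k -> e (x l) (x k) != 0.
  rewrite /x; case: (unliftP ord0 k) => [k'|] ->; case: (unliftP ord0 l) => [l'|] ->;
    rewrite ?node0 ?node_lift ?(inj_eq lift_inj) ?eqxx //.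
    by move=> lk; case: (hd' k') => _ _; apply.
  by move=> _; case: (hd' k').
have x_mem k : exists m, a m = x k.
  by rewrite /x /node; case: unliftP => [k'|] _; [exists (i k') | exists j].
have nopole m nu : qpoch q (a m * latt q xi nu) != 0 by have [+ _] := hcvg ord0; apply.
have v_shift : v (par q (fun m => alpha m + (m == j)%:R)) i = v a i.
  have pari l : par q (fun m => alpha m + (m == j)%:R) (i l) = a (i l).
    by rewrite /a /par eq_sym (negPf (hj l)) addr0.
  apply/funext => k; apply/funext => z; rewrite /v.
  by case: unliftP => *; apply: eq_bigr => l _; rewrite pari.
pose term phi := jackson_term q alpha xi logxi phi.
pose J phi := jackson q alpha xi logxi phi.
have v_cvg k : bicvg (term (v a i k)) by have [] := hcvg k.
have ev_cvg k : bicvg (term (fun z => e z (a j) * v a i k z)).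
  have [_] := hcvgT k; rewrite v_shift (jackson_term_shift hq0 hq1 _ hxi) //.
have J_shift k : qshift j (jackson_vec q xi logxi i) alpha 0 k =
    J (fun z => e z (a j) * v a i k z).
  by rewrite /qshift mxE v_shift /jackson (jackson_term_shift hq0 hq1 _ hxi).
have J_lift k : J (fun z => e z (a j) * v a i (lift ord0 k) z) =
    J (v a i ord0) + c a i j k * J (v a i (lift ord0 k)).
  rewrite -[RHS]jackson_linear //; congr (jackson _ _ _ _ _).
  by apply/funext => z; exact: e_mul_vlift.
(* Column 0: the contiguity relation, with the top coefficient divided out. *)
have J_0 : J (fun z => e z (a j) * v a i ord0 z) = c0 a i j * J (v a i ord0)
    + \sum_k d a i j k * J (fun z => e z (a j) * v a i (lift ord0 k) z).
  apply: (mulfI A1).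
  have full_eq : (fun z => \prod_k e z (x k)) = fun z => e z (a j) * v a i ord0 z.
    by apply/funext => z; rewrite prod_node.
  have omit0 : (fun z => \prod_(l | l != ord0) e z (x l)) = v a i ord0.
    by apply/funext => z; rewrite prod_node_omit0.
  have omitl k : (fun z => \prod_(l | l != lift ord0 k) e z (x l)) =
      fun z => e z (a j) * v a i (lift ord0 k) z.
    by apply/funext => z; rewrite prod_node_omit_lift.
  have := jackson_contiguity hq0 hq1 hxi nopole x_neq0 x2_neq1 x_sep x_mem.
  rewrite full_eq => ->; last 2 first.
  - exact: ev_cvg.
  - move=> k; case: (unliftP ord0 k) => [k'|] ->; rewrite ?omitl ?omit0.
      exact: ev_cvg.
    exact: v_cvg.
  rewrite big_ord_recl omit0 interp_coef_node0 // mulrDr -!mulrA; congr (_ + _).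
  rewrite mulr_sumr; apply: eq_bigr => k _.
  by rewrite omitl interp_coef_node_lift // -mulrA.
apply/rowP => k; rewrite J_shift; case: (unliftP ord0 k) => [k'|] ->.
  by rewrite mulUL_tail !mxE J_lift.
rewrite mulUL_head !mxE J_0; congr (_ + _).
by apply: eq_bigr => l _; rewrite J_lift !mxE.
Qed.
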